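(* Let $k$ be a positive integer, $F=\{1,2,\dots,k\}$ and $\mathfrak{p}_F(x)=\prod_{j\in F}(x-j)$. Let $\alpha,c,N$ be real numbers such that none of $\alpha+c-N+k+2$, $\alpha-N+1$, $\alpha+c$, $c$ belongs to $\{0,-1,-2,\dots\}$. Let $$h(x)=\sum_{j=0}^k\frac{(-k)_j(1-c-k+j)_{k-j}(N-k+j)_{k-j}}{j!}(-1)^j\prod_{i=0}^{j-1}\big[x+i(\alpha+c-N+k-1-i)\big]$$ (a dual Hahn polynomial), and assume that $$h\big(n(n+\alpha+c-N+k-1)\big)\neq 0\quad\text{for all } n\ge 0.$$ Then the orthogonal polynomials with respect to the moment functional $\mathfrak{p}_F\,\rho_{\alpha,c,N}$, where $\rho_{\alpha,c,N}$ is the Hahn moment functional, are common eigenfunctions of a difference operator of order $2k+2$ and genre $(-k-1,k+1)$.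
   Context: For $l\in\mathbb{Z}$ the shift operator $\mathfrak{s}_l$ acts on polynomials by $\mathfrak{s}_l(f)(x)=f(x+l)$. A finite difference operator $\sum_{l=s}^r f_l\,\mathfrak{s}_l$ (with polynomial coefficients $f_l$) with $f_s,f_r\neq 0$ has order $r-s$ and genre $(s,r)$. Polynomials $(q_n)_n$ are common eigenfunctions of such an operator $D$ (whose coefficients do not depend on $n$) if $D(q_n)=\lambda_nq_n$ for some numbers $\lambda_n$. $(y)_j=y(y+1)\cdots(y+j-1)$, $(y)_0=1$; empty products equal $1$. Monic Hahn polynomials ($\alpha+c-N\neq -1,-2,\dots$): $h_n^{\alpha,c,N}(x)=\sum_{j=0}^n\frac{(-n)_j(-x)_j(1-N+j)_{n-j}(c+j)_{n-j}}{(n+\alpha+c-N+j)_{n-j}\,j!}$. A moment functional is a linear map $\mu:\mathbb{P}\to\mathbb{R}$ on the space $\mathbb{P}$ of real polynomials; for a polynomial $r$, $\langle r\mu,p\rangle=\langle\mu,rp\rangle$. Hahn moment functional $\rho_{\alpha,c,N}$: if $N$ is not a positive integer and none of $\alpha+c-N+1,\alpha-N+1,\alpha+c,c$ is in $\{0,-1,-2,\dots\}$, it is the moment functional with respect to which $(h_n^{\alpha,c,N})_n$ are orthogonal, normalized by $\langle\rho_{\alpha,c,N},1\rangle=\frac{\Gamma(\alpha+1-N)\Gamma(c)\Gamma(\alpha+c)}{\Gamma(\alpha+c+1-N)}$; if $N$ is a positive integer, it is the measure $\rho_{\alpha,c,N}=\Gamma(N)\sum_{x=0}^{N-1}\frac{\Gamma(\alpha-x)\Gamma(x+c)}{\Gamma(N-x)x!}\delta_x$.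 Orthogonal polynomials with respect to $\mu$ are polynomials $(q_n)_n$ (a finite or infinite family) with $\deg q_n=n$, $\langle\mu,q_nx^m\rangle=0$ for $0\le m<n$ and $\langle\mu,q_nx^n\rangle\neq 0$. *)

(* Defs.v *)
From HB Require Import structures.
From mathcomp Require Import all_boot all_order all_algebra.
From mathcomp Require Import all_classical all_reals all_analysis.

Set Implicit Arguments.
Unset Strict Implicit.
Unset Printing Implicit Defensive.

Import Order.TTheory GRing.Theory Num.Theory.
Local Open Scope ring_scope.

Definition nonpos_int (R : realType) (x : R) : Prop :=
  exists m : nat, x = - m%:R.

(* Rising factorial; with y a polynomial it also gives (-'X)_j. *)
Definition poch (A : pzRingType) (y : A) (j : nat) : A :=
  \prod_(i < j) (y + i%:R).

Definition Euler_integral (R : realType) (x : R) : R :=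
  \int[lebesgue_measure]_(t in `]0, +oo[) (t `^ (x - 1) * expR (- t)).

(* Euler's integral for x > 0, extended to the negative non-integers by
   Gamma x = Gamma (x + n) / (x)_n, where n is the least natural number such
   that x + n > 0.  Meaningless when x is a nonpositive integer. *)
Definition Gamma (R : realType) (x : R) : R :=
  if 0 < x then Euler_integral x
  else let n := (Num.truncn (- x)).+1 in
       Euler_integral (x + n%:R) / poch x n.

Section DifferenceOperators.
Variable R : realType.
Implicit Types p : {poly R}.

Definition shiftp (l : int) p : {poly R} := p \Po ('X + (l%:~R)%:P).

(* The values of [dcoef] outside [dlo, dhi] play no role. *)
Record diffop := DiffOp {
  dlo : int;
  dhi : int;
  dcoef : int -> {poly R};
  dlo_le_dhi : dlo <= dhi;
  dcoef_lo : dcoef dlo != 0;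
  dcoef_hi : dcoef dhi != 0
}.

Definition diffop_genre (D : diffop) : int * int := (dlo D, dhi D).

Definition diffop_order (D : diffop) : nat := `|dhi D - dlo D|%N.

Definition diffop_app (D : diffop) p : {poly R} :=
  \sum_(i < (diffop_order D).+1) dcoef D (dlo D + i%:Z) * shiftp (dlo D + i%:Z) p.

End DifferenceOperators.

Section Families.
Variable R : realType.
Implicit Types (mu : {scalar {poly R}}) (r p : {poly R}).

Definition mulfun r mu : {poly R} -> R := fun p => mu (r * p).

Fact mulfun_is_scalar r mu : scalar (mulfun r mu).
Proof. by move=> a u v; rewrite /mulfun mulrDr -scalerAr linearP. Qed.

HB.instance Definition _ r mu :=
  GRing.isLinear.Build R {poly R} R *%R (mulfun r mu) (mulfun_is_scalar r mu).

(* A family (q_n)_n is given by q : nat -> {poly R} together with its length: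
   [Some L] for the finite family q_0, ..., q_{L-1}, [None] for an infinite
   one. *)
Definition in_family (len : option nat) (n : nat) : bool :=
  if len is Some L then (n < L)%N else true.

Definition orthogonal_polys mu (len : option nat) (q : nat -> {poly R}) : Prop :=
  forall n : nat, in_family len n ->
    [/\ size (q n) = n.+1,
        forall m : nat, (m < n)%N -> mu (q n * 'X^m) = 0
      & mu (q n * 'X^n) != 0].

Definition common_eigenfunctions (D : diffop R) (len : option nat)
    (q : nat -> {poly R}) : Prop :=
  exists lambda : nat -> R, forall n : nat, in_family len n ->
    diffop_app D (q n) = lambda n *: q n.

End Families.

Section Hahn.
Variable R : realType.
Implicit Types (a c N : R).

Definition hahn a c N (n : nat) : {poly R} :=
  \sum_(j < n.+1)
     (poch (- n%:R) j * poch (1 - N + j%:R) (n - j) * poch (c + j%:R) (n - j)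
      / (poch (n%:R + a + c - N + j%:R) (n - j) * (j`!)%:R)) *: poch (- 'X) j.

(* A relation rather than a function: the Hahn functional is only specified
   for the parameters covered by one of the two clauses. *)
Definition hahn_functional a c N (rho : {scalar {poly R}}) : Prop :=
  (exists M : nat, [/\ (0 < M)%N, N = M%:R
     & forall p : {poly R},
         rho p = Gamma N *
           \sum_(x < M) Gamma (a - x%:R) * Gamma (x%:R + c)
                        / (Gamma (N - x%:R) * (x`!)%:R) * p.[x%:R]])
  \/
  [/\ ~ (exists M : nat, (0 < M)%N /\ N = M%:R),
      [/\ ~ nonpos_int (a + c - N + 1), ~ nonpos_int (a - N + 1),
          ~ nonpos_int (a + c) & ~ nonpos_int c],
      orthogonal_polys rho None (hahn a c N)
    & rho 1 = Gamma (a + 1 - N) * Gamma c * Gamma (a + c)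
              / Gamma (a + c + 1 - N)].

Definition dual_hahn a c N (k : nat) : {poly R} :=
  \sum_(j < k.+1)
     (poch (- k%:R) j * poch (1 - c - k%:R + j%:R) (k - j)
        * poch (N - k%:R + j%:R) (k - j) / (j`!)%:R * (-1) ^+ j) *:
     \prod_(i < j) ('X + (i%:R * (a + c - N + k%:R - 1 - i%:R))%:P).

Definition pF (F : seq nat) : {poly R} := \prod_(j <- F) ('X - (j%:R)%:P).

End Hahn.

(* Main.v *)
Require Import Defs.
From HB Require Import structures.
From mathcomp Require Import all_boot all_order all_algebra.
From mathcomp Require Import all_classical all_reals all_analysis.
From mathcomp Require Import measurable_realfun.
From mathcomp Require Import ring lra zify.
Import Order.TTheory GRing.Theory Num.Theory.
Import numFieldNormedType.Exports.
Local Open Scope ring_scope.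

(** Put B(x) = (x + c)(N - 1 - x), D_m(x) = (x - m)(a - x) and let L_m be the
    Hahn operator f |-> B(x)(f(x) - f(x + 1)) + D_m(x)(f(x) - f(x - 1)), which
    is triangular with eigenvalues n(n + a + c - N + m).  All that is used of
    the Hahn functional rho is Pearson's equation
    rho(B(x) f(x + 1)) = rho(D_0(x) f(x)) ([Pearson_weight] for the finite
    measure, [Pearson_hahn] for the functional given by orthogonality).  It
    makes L_m symmetric for the functional (-x)_m rho.

    For F = {1, ..., k} one has x p_F(x) = +-(-x)_{k+1}.  Hence nu = p_F rho,
    multiplied by x, is the functional of L_{k+1}, and any combination of an
    eigenfunction P of degree n and an eigenfunction Q of degree n - 1 of
    L_{k+1} is nu-orthogonal to x, ..., x^{n-1}.  What remains is the condition
    nu(q) = 0.  Expanding p_F in the (-x)_j reduces nu(P) to the numbers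
    rho((-x)_j P), which satisfy a two-term recurrence in j because P is an
    eigenfunction ([moment_rec]); summing up, nu(P) is h(x_{n+1}) times
    rho((-x)_k P) up to a constant independent of n, where h is the dual Hahn
    polynomial and x_n = n(n + a + c - N + k - 1) ([dual_hahn_moment]).

    For n > 0 let u be the eigenfunction of degree n of L_k.  It splits as
    u = P + Q with P and Q as above ([eigen_split]), and rho((-x)_k u) = 0, so that
    q_n = h(x_n) P + h(x_{n+1}) Q is the orthogonal polynomial.  Now let
    s = a + c - N + k + 1 and Lambda = L_{k+1} + s - 1, an operator with
    eigenvalue x_{n+1} at P and x_n at Q.  Then h(Lambda) q_n is the multiple
    h(x_n) h(x_{n+1}) u of u, and the first order operator
    T = L_{k+1} - L_k = (x - a) nabla sends u to n P - (n + s - 1) Q.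
    Consequently q_n is an eigenfunction of

      Pol(Lambda) + (T + s/2) h(Lambda)

    as soon as the polynomial Pol solves
    Pol(x_{n+1}) - Pol(x_n) = -((n + s/2) h(x_{n+1}) + (n - 1 + s/2) h(x_n)).
    Such a Pol of degree k + 1 exists, explicitly in the basis that defines h
    ([dual_basis_sum]), and the extreme coefficients of the operator are then
    nonzero ([krall_hahn_diffop]).

    The case s = 0 is exceptional, because L_k then has the eigenvalue 0 twice
    and u need not exist in degree 1.  But nu(1) = 0 in that case
    ([nu_const_eq0]), so that only the empty family is orthogonal. *)

(** * Euler's integral and the functional equation of Gamma *)

Section EulerIntegral.
Local Open Scope classical_set_scope.
Local Open Scope ring_scope.
Variable R : realType.
Implicit Types x t : R.
Local Notation mu := (@lebesgue_measure R).
Local Notation kern x := (fun t : R => t `^ (x - 1) * expR (- t)).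
Local Notation window n := (`[(n.+2%:R : R)^-1, n.+2%:R]%classic : set R).

Lemma window_bigcup : (\bigcup_n window n)%classic = `]0, +oo[%classic.
Proof.
apply/seteqP; split => t /=.
  move=> [n _] /=; rewrite !in_itv /= andbT => /andP[+ _].
  by apply: lt_le_trans; rewrite invr_gt0.
rewrite in_itv /= andbT => t0.
exists (Num.truncn (t + t^-1)).+1 => //=; rewrite in_itv /=.
have tV : 0 < t^-1 by rewrite invr_gt0.
have le : t + t^-1 <= ((Num.truncn (t + t^-1)).+3)%:R.
  apply: le_trans (ltW (truncnS_gt _)) _; rewrite ler_nat.
  exact: leqW (leqnSn _).
apply/andP; split; last by apply: le_trans le; rewrite lerDl ltW.
by rewrite invf_ple ?posrE//; apply: le_trans le; rewrite lerDr ltW.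
Qed.

Lemma window_nondecreasing : nondecreasing_seq (fun n => window n).
Proof.
move=> m n mn; rewrite subsetEset => t /=; rewrite !in_itv /= => /andP[h1 h2].
apply/andP; split; last by apply: le_trans h2 _; rewrite ler_nat !ltnS.
by apply: le_trans h1; rewrite lef_pV2 ?posrE// ler_nat !ltnS.
Qed.

Lemma measurable_kern x : measurable_fun [set: R] (kern x).
Proof.
apply: measurable_funM => //.
apply: measurableT_comp => //.
Qed.

Lemma kern_ge0 x t : 0 <= kern x t.
Proof. by rewrite mulr_ge0 ?powR_ge0 ?expR_ge0. Qed.

Lemma cvg_integral_window x :
  (\int[mu]_(t in window n) (kern x t)%:E @[n --> \oo] -->
   \int[mu]_(t in `](0:R)%R, +oo[) (kern x t)%:E)%E.
Proof.
rewrite -window_bigcup.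
apply: ge0_nondecreasing_set_cvg_integral => //.
- exact: window_nondecreasing.
- move=> n; apply/measurable_EFinP; apply: measurable_funTS.
  exact: measurable_kern.
- by move=> n t _; rewrite lee_fin kern_ge0.
Qed.

(** The bound comes from the term of degree [(Num.truncn x).+2] of the
    exponential series. *)
Lemma powR_expRN_small x t : 0 < x -> 1 <= t ->
  t `^ x * expR (- t) <= ((Num.truncn x).+2)`!%:R / t.
Proof.
move=> x0 t1; have t0 : 0 < t by apply: lt_le_trans t1.
set m := (Num.truncn x).+1.
rewrite expRN ler_pdivrMr ?expR_gt0// mulrAC ler_pdivlMr//.
have h : t `^ x <= t ^+ m.
  rewrite -powR_mulrn ?(ltW t0)//; apply: ler_powR => //.
  by apply: ltW; apply: truncnS_gt.
apply: (@le_trans _ _ (t ^+ m.+1)).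
  by rewrite exprSr ler_wpM2r// ltW.
rewrite mulrC -ler_pdivrMr ?ltr0n ?fact_gt0//.
by apply: le_trans (expR_ge1Dxn m (ltW t0)); rewrite lerDr.
Qed.

Lemma cvg_boundary_infty x : 0 < x ->
  (n.+2%:R : R) `^ x * expR (- n.+2%:R) @[n --> \oo] --> (0 : R).
Proof.
move=> x0.
apply: (@squeeze_cvgr _ _ _ _ (fun=> 0)
   (fun n => ((Num.truncn x).+2)`!%:R * n.+1%:R^-1)).
- apply: nearW => n; rewrite mulr_ge0 ?powR_ge0 ?expR_ge0//=.
  apply: le_trans (powR_expRN_small _ _ x0 _) _; first by rewrite ler1n.
  by rewrite ler_wpM2l// lef_pV2 ?posrE// ler_nat.
- exact: cvg_cst.
- rewrite -[X in _ --> X](mulr0 (((Num.truncn x).+2)`!%:R : R)).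
  apply: cvgM; first exact: cvg_cst.
  exact: cvg_harmonic.
Qed.

Lemma cvg_boundary_zero x : 0 < x ->
  (n.+2%:R^-1 : R) `^ x * expR (- n.+2%:R^-1) @[n --> \oo] --> (0 : R).
Proof.
move=> x0.
apply: (@squeeze_cvgr _ _ _ _ (fun=> 0) (fun n => (n.+2%:R^-1 : R) `^ x)).
- apply: nearW => n; rewrite mulr_ge0 ?powR_ge0 ?expR_ge0//=.
  rewrite ler_piMr ?powR_ge0// -expR0 ler_expR oppr_le0 invr_ge0//.
- exact: cvg_cst.
- have h : (n.+2%:R^-1 : R) @[n --> \oo] --> (0 : R).
    apply: (@squeeze_cvgr _ _ _ _ (fun=> 0) (fun n => n.+1%:R^-1)).
    - apply: nearW => n; apply/andP.
      by split; rewrite ?invr_ge0// lef_pV2 ?posrE// ler_nat.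
    - exact: cvg_cst.
    - exact: cvg_harmonic.
  by move/cvg_at_rightP: (powR_cvg0 x0); apply; split.
Qed.

Lemma integral_window_by_parts x n :
  (\int[mu]_(t in window n) (kern (x + 1) t)%:E =
   x%:E * \int[mu]_(t in window n) (kern x t)%:E +
   ((n.+2%:R^-1 : R) `^ x * expR (- n.+2%:R^-1)
     - (n.+2%:R : R) `^ x * expR (- n.+2%:R))%:E)%E.
Proof.
set p : R := n.+2%:R^-1; set q : R := n.+2%:R.
have p0 : 0 < p by rewrite invr_gt0.
have pq : p < q.
  by apply: (@lt_trans _ _ 1); rewrite /p /q ?invf_lt1 ?ltr1n.
pose F t : R := t `^ x * expR (- t).
pose f t : R := x * kern x t - kern (x + 1) t.
have dF t : 0 < t -> is_derive t 1 F (f t).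
  move=> t0; rewrite /F /f.
  have h1 := @is_derive1_powR _ x _ t0.
  have h2 : is_derive t 1 (fun t : R => expR (- t)) (- expR (- t)).
    rewrite -[X in is_derive _ _ _ X]mulN1r mulrC.
    exact: (@is_derive1_comp _ expR (fun t : R => - t) t _ _ (is_derive_expR _)).
  have h3 := is_deriveM h1 h2.
  apply: is_derive_eq h3 _.
  by rewrite /GRing.scale /= addrK; ring.
have posI t : t \in `[p, q] -> 0 < t.
  by rewrite in_itv /= => /andP[+ _]; apply: lt_le_trans.
have dkern y t : 0 < t -> derivable (kern y) t 1.
  move=> t0; apply: derivableM.
    by apply: derivable_powR; rewrite in_itv /= t0.
  by apply: ex_derive.
have intkern y : mu.-integrable `[p, q] (fun t => (kern y t)%:E).
  apply: continuous_compact_integrable; first exact: segment_compact.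
  by apply: derivable_within_continuous => t /posI; exact: dkern.
have cf : {within `[p, q], continuous f}.
  apply: derivable_within_continuous => t /posI t0.
  by apply: derivableB; [apply: derivableM => //|]; exact: dkern.
have cF t : 0 < t -> {for t, continuous F}.
  move=> t0; apply/differentiable_continuous/derivable1_diffP.
  by case: (dF t t0).
have LRF : derivable_oo_LRcontinuous F p q.
  split.
  - move=> t; rewrite in_itv /= => /andP[pt _].
    by case: (dF t (lt_trans p0 pt)).
  - exact: cvg_at_right_filter (cF _ p0).
  - exact: cvg_at_left_filter (cF _ (lt_trans p0 pq)).
have dFf : {in `]p, q[, derive1 F =1 f}.
  move=> t; rewrite in_itv /= => /andP[pt _].
  by rewrite derive1E; case: (dF t (lt_trans p0 pt)).
have := continuous_FTC2 pq cf LRF dFf.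
under eq_integral do rewrite EFinB EFinM.
rewrite integralB_EFin//; [|exact: (integrableZl _ x (intkern x))|exact: intkern].
under [X in (X - _)%E]eq_integral do rewrite EFinM.
rewrite integralZl//.
have fin y : exists r, (\int[mu]_(t in `[p, q]) (kern y t)%:E = r%:E)%E.
  exists (fine (\int[mu]_(t in `[p, q]) (kern y t)%:E)%E).
  by rewrite fineK// integrable_fin_num.
have [r ->] := fin x; have [r' ->] := fin (x + 1).
rewrite -!EFinM -!EFinB -EFinD => -[e]; congr EFin.
by move: e; rewrite /F; lra.
Qed.

(** The limit of the integrations by parts is taken in the extended reals, so
    that the convergence of the integrals is not an issue: if both integrals
    are infinite, both sides vanish. *)
Lemma Euler_integral_rec x : 0 < x ->
  Euler_integral (x + 1) = x * Euler_integral x.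
Proof.
move=> x0; rewrite /Euler_integral /Rintegral.
suff -> : (\int[mu]_(t in `](0:R)%R, +oo[) (kern (x + 1) t)%:E =
   x%:E * \int[mu]_(t in `](0:R)%R, +oo[) (kern x t)%:E)%E.
  case: (\int[mu]_(t in _) _)%E => [r||] /=; first by [].
    by rewrite gt0_muley ?lte_fin//= mulr0.
  by rewrite gt0_muleNy ?lte_fin//= mulr0.
suff lim : (\int[mu]_(t in window n) (kern (x + 1) t)%:E @[n --> \oo] -->
    x%:E * \int[mu]_(t in `](0:R)%R, +oo[) (kern x t)%:E)%E.
  by apply: cvg_unique (cvg_integral_window (x + 1)) lim.
under eq_cvg do rewrite integral_window_by_parts.
rewrite -[(x%:E * _)%E]adde0.
apply: cvgeD; first by rewrite fin_num_adde_defl.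
  apply: cvgeZl => //; exact: cvg_integral_window.
apply: cvg_EFin; first exact: nearW.
rewrite -(subr0 (0 : R)).
apply: cvgB; first exact: cvg_boundary_zero.
exact: cvg_boundary_infty.
Qed.

End EulerIntegral.

Lemma pochS (A : pzRingType) (y : A) j : poch y j.+1 = poch y j * (y + j%:R).
Proof. by rewrite /poch big_ord_recr. Qed.

Lemma poch_recl (A : pzRingType) (y : A) j : poch y j.+1 = y * poch (y + 1) j.
Proof.
rewrite /poch big_ord_recl addr0; congr (_ * _); apply: eq_bigr => i _.
by rewrite lift0 -natr1 -addrA [1 + _]addrC.
Qed.

Lemma nonpos_intD (R : realType) (x : R) n :
  ~ nonpos_int x -> ~ nonpos_int (x + n%:R).
Proof.
by move=> h [m e]; apply: h; exists (m + n)%N; rewrite natrD opprD -e; ring.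
Qed.

Lemma nonpos_int_neq0 (R : realType) (x : R) n : ~ nonpos_int x -> x + n%:R != 0.
Proof.
by move=> h; apply/eqP => e; apply: h; exists n; apply/eqP; rewrite -addr_eq0 e.
Qed.

(** For negative x, the number of steps into the positive axis drops by one
    from x to x + 1. *)
Lemma Gamma_rec (R : realType) (x : R) :
  ~ nonpos_int x -> Gamma (x + 1) = x * Gamma x.
Proof.
move=> hx.
have x0 : x != 0 by have := nonpos_int_neq0 _ _ 0 hx; rewrite addr0.
rewrite /Gamma; case: (ltrP 0 x) => [xp|xn].
  by rewrite ltr_wpDr// Euler_integral_rec.
have {x0 xn} xn : x < 0 by rewrite lt_neqAle x0.
set n := Num.truncn (- x).
have /andP[nlo nhi] : n%:R <= - x < n.+1%:R.
  by apply: truncn_itv; rewrite oppr_ge0 ltW.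
case: ltrP => [x1|x1].
  have -> : n = 0.
    by apply/eqP; rewrite -leqn0 leqNgt; apply/negP; rewrite -(ler_nat R); lra.
  rewrite /poch big_ord_recl big_ord0 mulr1 addr0.
  by rewrite mulrCA divff ?mulr1// lt_eqF.
case: n nlo nhi => [|n] nlo nhi.
  have e : x = - 1 by lra.
  by case: hx; exists 1.
have -> : Num.truncn (- (x + 1)) = n.
  by apply: truncn_def; rewrite -!natr1 in nlo nhi *; lra.
rewrite (_ : x + n.+2%:R = x + 1 + n.+1%:R); last by rewrite -!natr1; ring.
rewrite (poch_recl _ x n.+1) invfM [RHS]mulrCA mulVKf ?lt_eqF//.
Qed.

(** * Polynomials, shifts and the falling factorials *)

Section KrallHahn.
Context {R : realType}.
Implicit Types (a c N m t x y s : R) (f g p u b : {poly R}).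
Implicit Types (C : nat -> {poly R}) (rho : {scalar {poly R}}).

(** Operator identities are checked pointwise, where they become identities of
    field elements. *)
Lemma eq_poly_horner f g : (forall x, f.[x] = g.[x]) -> f = g.
Proof.
move=> fg; apply/eqP; rewrite -subr_eq0; apply/eqP/(@roots_geq_poly_eq0 _ _
  (map (fun i : nat => i%:R) (iota 0 (size (f - g))))).
- by apply/allP => x /mapP[i _ ->]; rewrite /root !hornerE fg subrr.
- rewrite map_inj_uniq ?iota_uniq// => i j /eqP; rewrite eqr_nat => /eqP; exact.
- by rewrite size_map size_iota.
Qed.

Lemma coef_last_neq0 d f : size f = d.+1 -> f`_d != 0.
Proof.
move=> s; have := lead_coef_eq0 f.
by rewrite /lead_coef s => ->; rewrite -size_poly_gt0 s.
Qed.

Lemma size_cancel_lead d f g : (size f <= d.+1)%N -> size g = d.+1 ->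
  (size (f - (f`_d / g`_d) *: g)%R <= d)%N.
Proof.
move=> sf sg; apply/leq_sizeP => i; rewrite leq_eqVlt => /orP[/eqP <-|di].
  by rewrite coefB coefZ divfK ?subrr// coef_last_neq0.
have /leq_sizeP/(_ i di) fi := sf; have /eq_leq/leq_sizeP/(_ i di) gi := sg.
by rewrite coefB coefZ fi gi mulr0 subrr.
Qed.

Lemma horner_shiftp l f x : (shiftp l f).[x] = f.[x + l%:~R].
Proof. by rewrite /shiftp horner_comp !hornerE. Qed.

HB.instance Definition _ (l : int) := GRing.RMorphism.copy (@shiftp R l)
  (comp_poly ('X + (l%:~R)%:P)).
HB.instance Definition _ (l : int) := GRing.Linear.copy (@shiftp R l)
  (comp_poly ('X + (l%:~R)%:P)).

Lemma shiftp_comp l l' f : shiftp l (shiftp l' f) = shiftp (l + l') f.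
Proof.
by apply: eq_poly_horner => x; rewrite !horner_shiftp intrD addrA.
Qed.

Lemma shiftp0 f : shiftp 0 f = f.
Proof. by apply: eq_poly_horner => x; rewrite horner_shiftp addr0. Qed.

Lemma shiftp_neq0 l f : f != 0 -> shiftp l f != 0.
Proof.
apply: contra => /eqP e.
by rewrite -[f]shiftp0 -(addNr l) -shiftp_comp e linear0.
Qed.

Definition nabla f : {poly R} := f - shiftp (-1) f.

Fact nabla_is_linear : linear nabla.
Proof. by move=> t f g; rewrite /nabla linearP scalerBr; ring. Qed.

HB.instance Definition _ :=
  GRing.isLinear.Build R {poly R} {poly R} *:%R nabla nabla_is_linear.

(** Up to a sign, a falling factorial of x - m. *)
Definition desc m j : {poly R} := poch (m%:P - 'X) j.

Lemma horner_poch (p : {poly R}) j x : (poch p j).[x] = poch p.[x] j.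
Proof.
rewrite /poch horner_prod; apply: eq_bigr => i _.
by rewrite hornerD -polyC_natr hornerC.
Qed.

Lemma horner_desc m j x : (desc m j).[x] = poch (m - x) j.
Proof. by rewrite horner_poch !hornerE. Qed.

Lemma desc0 m : desc m 0 = 1.
Proof. by rewrite /desc /poch big_ord0. Qed.

Lemma descS m j : desc m j.+1 = desc m j * ((m + j%:R)%:P - 'X).
Proof. by rewrite /desc pochS polyCD polyC_natr addrAC. Qed.

Lemma desc_recl m j : desc m j.+1 = (m%:P - 'X) * desc (m + 1) j.
Proof. by rewrite /desc poch_recl polyCD polyC1 addrAC. Qed.

Lemma size_desc m j : size (desc m j) = j.+1.
Proof.
elim: j => [|j IH]; first by rewrite desc0 size_poly1.
have s2 : size ((m + j%:R)%:P - 'X) = 2.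
  by rewrite -size_polyN opprB size_XsubC.
by rewrite descS size_mul ?IH ?s2 -?size_poly_gt0 ?IH ?s2// addn2.
Qed.

Lemma desc_split m d f : (size f <= d.+1)%N ->
  exists t g, (size g <= d)%N /\ f = t *: desc m d + g.
Proof.
move=> sf; have := size_cancel_lead _ _ _ sf (size_desc m d); set t := _ / _ => sg.
by exists t, (f - t *: desc m d); split=> //; rewrite addrC subrK.
Qed.

Lemma nabla_surj f : exists g, f = nabla g.
Proof.
move: {2}(size f) (leqnn (size f)) => d; elim: d f => [|d IH] f sf.
  by exists 0; rewrite linear0; apply/eqP; rewrite -size_poly_leq0.
have [t [g [sg ->]]] := desc_split 1 _ _ sf.
have [g' ->] := IH _ sg.
exists ((- t / d.+1%:R) *: desc 0 d.+1 + g'); rewrite linearD linearZ /=.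
congr (_ + _); apply: eq_poly_horner => x.
rewrite /nabla !hornerE !horner_shiftp !horner_desc sub0r [0 - _]sub0r.
have -> : - (x + (-1)%:~R) = 1 - x by ring.
rewrite poch_recl pochS [- x + 1]addrC; move: (poch _ d) => P.
by field; rewrite nat1r pnatr_eq0.
Qed.

(** * The Hahn operators *)

Definition upcoef c N : {poly R} := ('X + c%:P) * ((N - 1)%:P - 'X).

Definition downcoef a m : {poly R} := ('X - m%:P) * (a%:P - 'X).

(** At m = 0 this is the operator of the Hahn polynomials; at m it is the one
    of the functional obtained from the Hahn functional by multiplication with
    the m-th falling factorial. *)
Definition hahn_op a c N m f : {poly R} :=
  upcoef c N * (f - shiftp 1 f) + downcoef a m * nabla f.

Lemma horner_hahn_op a c N m f x : (hahn_op a c N m f).[x] =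
  (x + c) * (N - 1 - x) * (f.[x] - f.[x + 1]) +
  (x - m) * (a - x) * (f.[x] - f.[x - 1]).
Proof.
by rewrite /hahn_op /nabla /upcoef /downcoef !hornerE !horner_shiftp.
Qed.

Fact hahn_op_is_linear a c N m : linear (hahn_op a c N m).
Proof.
move=> t f g; apply: eq_poly_horner => x.
rewrite [RHS]hornerD hornerZ !horner_hahn_op !hornerE /=; ring.
Qed.

HB.instance Definition _ a c N m := GRing.isLinear.Build R {poly R} {poly R} *:%R
  (hahn_op a c N m) (hahn_op_is_linear a c N m).

Lemma hahn_op_const a c N m t : hahn_op a c N m t%:P = 0.
Proof.
apply: eq_poly_horner => x.
by rewrite horner_hahn_op !hornerE !subrr !mulr0 addr0.
Qed.

(** In the falling factorials that start at m the operator is bidiagonal,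
    because D_m vanishes at m. *)
Lemma hahn_op_desc a c N m j : hahn_op a c N m (desc m j.+1) =
  (j.+1%:R * (j.+1%:R + (a + c - N + m))) *: desc m j.+1 +
  (j.+1%:R * (m + j%:R + c) * (N - 1 - m - j%:R)) *: desc m j.
Proof.
apply: eq_poly_horner => x.
rewrite horner_hahn_op !hornerD !hornerZ !horner_desc.
have -> : poch (m - (x + 1)) j.+1 = (m - x - 1) * poch (m - x) j.
  by rewrite poch_recl; congr (_ * poch _ _); ring.
have := poch_recl _ (m - x) j.+1; rewrite pochS.
have -> : m - (x - 1) = m - x + 1 by ring.
rewrite [poch (m - x) j.+1]pochS -natr1 => e.
transitivity ((x + c) * (N - 1 - x) * poch (m - x) j * (j%:R + 1)
  + (a - x) * ((x - m) * (poch (m - x) j * (m - x + j%:R)) +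
     (m - x) * poch (m - x + 1) j.+1)).
  ring.
rewrite -e /=; move: (poch (m - x) j) => P; ring.
Qed.

Definition hahn_eigval a c N m (n : nat) : R := n%:R * (n%:R + (a + c - N + m)).

Lemma hahn_eigval_inj a c N m n j :
  (forall i, (0 < i)%N -> i%:R + (a + c - N + m) != 0) ->
  (j < n)%N -> hahn_eigval a c N m j != hahn_eigval a c N m n.
Proof.
move=> nz jn; rewrite -subr_eq0.
have -> : hahn_eigval a c N m j - hahn_eigval a c N m n =
    (j%:R - n%:R) * ((j + n)%:R + (a + c - N + m)).
  by rewrite /hahn_eigval natrD; ring.
rewrite mulf_neq0 ?nz//; last by lia.
by rewrite subr_eq0 eqr_nat neq_ltn jn.
Qed.

Lemma hahn_op_triangular a c N m d f : (size f <= d.+1)%N ->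
  (size (hahn_op a c N m f - hahn_eigval a c N m d *: f)%R <= d)%N.
Proof.
elim: d f => [|d IH] f sf.
  rewrite [f]size1_polyC// hahn_op_const /hahn_eigval mul0r scale0r subrr.
  by rewrite size_poly0.
have [t [g [sg ->]]] := desc_split m _ _ sf.
have sLg : (size (hahn_op a c N m g) <= d.+1)%N.
  rewrite -[hahn_op a c N m g](subrK (hahn_eigval a c N m d *: g)).
  apply: leq_trans (size_polyD _ _) _; rewrite geq_max.
  by rewrite (leq_trans (IH _ sg))//= (leq_trans (size_scale_leq _ _)).
rewrite linearD linearZ /= hahn_op_desc -/(hahn_eigval a c N m d.+1).
set u := (_ * _) *: _.
have -> : t *: (hahn_eigval a c N m d.+1 *: desc m d.+1 + u) + hahn_op a c N m g -
   hahn_eigval a c N m d.+1 *: (t *: desc m d.+1 + g) =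
   t *: u + (hahn_op a c N m g - hahn_eigval a c N m d.+1 *: g).
  rewrite -!mul_polyC; ring.
apply: leq_trans (size_polyD _ _) _; rewrite geq_max; apply/andP; split.
  apply: leq_trans (size_scale_leq _ _) _; apply: leq_trans (size_scale_leq _ _) _.
  by rewrite size_desc.
apply: leq_trans (size_polyD _ _) _; rewrite geq_max size_polyN sLg /=.
exact: leq_trans (size_scale_leq _ _) sg.
Qed.

Lemma hahn_op_comp a c N m f :
  hahn_op a c N m (f \Po ('X - m%:P)) =
  hahn_op (a - m) (c + m) (N - m) 0 f \Po ('X - m%:P).
Proof.
apply: eq_poly_horner => x.
rewrite horner_comp !horner_hahn_op !horner_comp !hornerE.
rewrite [x + 1 - m]addrAC [x - 1 - m]addrAC /=; ring.
Qed.

(** The coefficients of the Hahn polynomial solve the two-term recurrence that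
    [hahn_op_desc] imposes on an eigenfunction. *)
Lemma hahn_eigen a c N n :
  (forall j, (0 < n + j)%N -> (n + j)%:R + (a + c - N) != 0) ->
  hahn_op a c N 0 (hahn a c N n) = hahn_eigval a c N 0 n *: hahn a c N n.
Proof.
move=> nz; rewrite /hahn.
set C := fun j : nat => poch (- n%:R) j * poch (1 - N + j%:R) (n - j) *
  poch (c + j%:R) (n - j) / (poch (n%:R + a + c - N + j%:R) (n - j) * j`!%:R).
have -> : \sum_(j < n.+1) C j *: poch (- 'X) j = \sum_(j < n.+1) C j *: desc 0 j.
  by apply: eq_bigr => j _; rewrite /desc polyC0 sub0r.
pose B (j : nat) := j.+1%:R * (j%:R + c) * (N - 1 - j%:R).
have LC : hahn_op a c N 0 (desc 0 0) = 0 by rewrite desc0 -polyC1 hahn_op_const.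
have LS j : hahn_op a c N 0 (desc 0 j.+1) =
    hahn_eigval a c N 0 j.+1 *: desc 0 j.+1 + B j *: desc 0 j.
  by rewrite hahn_op_desc; congr (_ + _ *: _); rewrite /B; ring.
suff main (e : nat -> {poly R}) : hahn_op a c N 0 (e 0) = 0 ->
    (forall j, hahn_op a c N 0 (e j.+1) =
       hahn_eigval a c N 0 j.+1 *: e j.+1 + B j *: e j) ->
    hahn_op a c N 0 (\sum_(j < n.+1) C j *: e j) =
    hahn_eigval a c N 0 n *: \sum_(j < n.+1) C j *: e j.
  exact: (main (fun j => desc 0 j)).
move=> {}LC {}LS; rewrite linear_sum /=.
have recC j : (j < n)%N ->
    (hahn_eigval a c N 0 n - hahn_eigval a c N 0 j) * C j = B j * C j.+1.
  move=> jn; rewrite /C.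
  have [i ni] : exists i, (n - j = i.+1)%N by exists (n - j).-1; lia.
  have -> : (n - j.+1 = i)%N by lia.
  rewrite ni (pochS _ _ j) !(poch_recl _ _ i) factS natrM.
  have q y : y + j%:R + 1 = y + j.+1%:R by rewrite -addrA natr1.
  rewrite !q.
  have h0 : n%:R + a + c - N + j%:R != 0.
    by have := nz j; rewrite natrD => /(_ ltac:(lia)); congr (_ != _); ring.
  have h1 : poch (n%:R + a + c - N + j.+1%:R) i != 0.
    apply/prodf_neq0 => l _.
    have := nz (j.+1 + l)%N; rewrite !natrD => /(_ ltac:(lia)).
    by congr (_ != _); ring.
  have h2 : j`!%:R != 0 :> R by rewrite pnatr_eq0 -lt0n fact_gt0.
  rewrite /hahn_eigval /B.
  move: (poch _ i) h1 (poch _ i) (poch _ i) (poch _ j) (j`!%:R) h2.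
  move=> P4 h1 P1 P2 P3 F h2.
  field.
  by rewrite h1 h0 h2 nat1r pnatr_eq0.
have ev0 : hahn_eigval a c N 0 0 = 0 by rewrite /hahn_eigval mul0r.
transitivity (\sum_(i < n.+1) (C i * hahn_eigval a c N 0 i) *: e i +
   \sum_(i < n.+1) ((hahn_eigval a c N 0 n - hahn_eigval a c N 0 i) * C i) *: e i).
  rewrite big_ord_recl linearZ /= LC scaler0 add0r.
  rewrite [X in _ = X + _]big_ord_recl ev0 mulr0 scale0r add0r.
  rewrite [X in _ = _ + X]big_ord_recr /= subrr mul0r scale0r addr0.
  rewrite -big_split; apply: eq_bigr => i _ /=.
  rewrite recC ?ltn_ord// /bump leq0n add1n linearZ /= LS.
  by rewrite scalerDr !scalerA [C _ * B _]mulrC.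
rewrite -big_split scaler_sumr; apply: eq_bigr => i _ /=.
by rewrite -scalerDl scalerA; congr (_ *: _); ring.
Qed.

Lemma size_hahn a c N n : size (hahn a c N n) = n.+1.
Proof.
rewrite /hahn big_ord_recr /= subnn.
have d0 j : poch (- 'X : {poly R}) j = desc 0 j by rewrite /desc polyC0 sub0r.
set t := (X in _ + X *: _); have t0 : t != 0.
  rewrite /t /poch !big_ord0 !mulr1 !mul1r mulf_neq0 ?invr_neq0 ?pnatr_eq0//.
    by apply/prodf_neq0 => i _; rewrite addrC subr_eq0 eqr_nat neq_ltn ltn_ord.
  by rewrite -lt0n fact_gt0.
rewrite addrC size_polyDl d0 size_scale ?size_desc// ltnS.
apply: leq_trans (size_sum _ _ _) _; apply/bigmax_leqP => i _.
apply: leq_trans (size_scale_leq _ _) _; rewrite d0 size_desc.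
exact: ltn_ord.
Qed.

Lemma hahn_shifted_eigen a c N m n :
  (forall j, (0 < j)%N -> j%:R + (a + c - N + m) != 0) ->
  hahn_op a c N m (hahn (a - m) (c + m) (N - m) n \Po ('X - m%:P)) =
  hahn_eigval a c N m n *: (hahn (a - m) (c + m) (N - m) n \Po ('X - m%:P)).
Proof.
move=> nz; rewrite hahn_op_comp hahn_eigen.
  by rewrite linearZ /=; congr (_ *: _); rewrite /hahn_eigval; ring.
by move=> j /nz; congr (_ != _); ring.
Qed.

(** * Contiguous eigenfunctions *)

(** The difference of two consecutive Hahn operators, see [hahn_op_slope_op]. *)
Definition slope_op a f : {poly R} := ('X - a%:P) * nabla f.

Lemma hahn_op_slope_op a c N m f :
  hahn_op a c N (m + 1) f = hahn_op a c N m f + slope_op a f.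
Proof.
apply: eq_poly_horner => x; rewrite hornerD /slope_op /nabla hornerM.
by rewrite !horner_hahn_op !hornerE horner_shiftp /=; ring.
Qed.

(** The coefficients of f(x - 2) on both sides agree, since
    (x - 1 - a) D_{m+1}(x) = (x - a) D_m(x - 1), so that the commutator is a
    three-term operator again. *)
Lemma hahn_op_commutation a c N m f :
  hahn_op a c N (m + 1) (slope_op a f) =
  slope_op a (hahn_op a c N m f) + hahn_op a c N m f
  - (a + c - N + m) *: slope_op a f.
Proof.
have horner_slope_op h x : (slope_op a h).[x] = (x - a) * (h.[x] - h.[x - 1]).
  by rewrite /slope_op /nabla !hornerE horner_shiftp.
apply: eq_poly_horner => x.
rewrite hornerD hornerN hornerZ hornerD !horner_hahn_op !horner_slope_op.
by rewrite !horner_hahn_op addrK subrK; ring.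
Qed.

(** On an eigenfunction of L_m the commutation relation becomes a quadratic
    equation for L_{m+1}, whose roots are two consecutive eigenvalues. *)
Lemma hahn_op_quadratic a c N m n u :
  hahn_op a c N m u = hahn_eigval a c N m n.+1 *: u ->
  hahn_op a c N (m + 1) (hahn_op a c N (m + 1) u) =
  (hahn_eigval a c N (m + 1) n.+1 + hahn_eigval a c N (m + 1) n) *:
    hahn_op a c N (m + 1) u -
  (hahn_eigval a c N (m + 1) n.+1 * hahn_eigval a c N (m + 1) n) *: u.
Proof.
move=> eu; have Tu : slope_op a u =
    hahn_op a c N (m + 1) u - hahn_eigval a c N m n.+1 *: u.
  by rewrite hahn_op_slope_op eu addrC addrA addNr add0r.
rewrite {1}[hahn_op a c N (m + 1) u]hahn_op_slope_op linearD /=.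
rewrite hahn_op_commutation eu linearZ /=.
have TZ t : slope_op a (t *: u) = t *: slope_op a u.
  by rewrite /slope_op linearZ /= scalerAr.
rewrite TZ Tu; move: (hahn_op a c N (m + 1) u) => v.
by apply: eq_poly_horner => x; rewrite !hornerE /hahn_eigval -natr1 /=; ring.
Qed.

(** P and Q are the spectral projections of u, which [hahn_op_quadratic] provides. *)
Lemma eigen_split a c N m n u :
  2 * n%:R + 1 + (a + c - N + (m + 1)) != 0 ->
  size u = n.+2 -> hahn_op a c N m u = hahn_eigval a c N m n.+1 *: u ->
  exists P Q, [/\ u = P + Q, size P = n.+2, (size Q <= n.+1)%N,
    hahn_op a c N (m + 1) P = hahn_eigval a c N (m + 1) n.+1 *: P &
    hahn_op a c N (m + 1) Q = hahn_eigval a c N (m + 1) n *: Q].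
Proof.
set d := (X in X != 0) => d0 su eu.
have dE : hahn_eigval a c N (m + 1) n.+1 - hahn_eigval a c N (m + 1) n = d.
  by rewrite /hahn_eigval /d -natr1; ring.
have quad := hahn_op_quadratic _ _ _ _ _ _ eu.
have tri := hahn_op_triangular a c N (m + 1) n.+1 u (eq_leq su).
move: quad tri dE; set L := hahn_op a c N (m + 1).
set e1 := hahn_eigval _ _ _ _ n.+1; set e0 := hahn_eigval _ _ _ _ n => quad tri dE.
pose P := d^-1 *: (L u - e0 *: u); pose Q := - d^-1 *: (L u - e1 *: u).
have sQ : (size Q <= n.+1)%N by apply: leq_trans (size_scale_leq _ _) tri.
have uPQ : u = P + Q.
  by apply: eq_poly_horner => x; rewrite !hornerE -dE /=; field; rewrite dE.
exists P, Q; split=> //.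
- have -> : P = u - Q by rewrite uPQ addrK.
  by rewrite size_polyDl ?size_polyN su.
- rewrite /P /L [LHS]linearZ /= linearB /= [hahn_op _ _ _ _ (_ *: u)]linearZ /=.
  rewrite -/L quad.
  move: (L u) => v; clearbody e0 e1.
  by apply: eq_poly_horner => x; rewrite !hornerE /=; ring.
- rewrite /Q /L [LHS]linearZ /= linearB /= [hahn_op _ _ _ _ (_ *: u)]linearZ /=.
  rewrite -/L quad.
  move: (L u) => v; clearbody e0 e1.
  by apply: eq_poly_horner => x; rewrite !hornerE /=; ring.
Qed.

(** * Pearson's equation *)

Definition Pearson a c N m rho : Prop :=
  forall f, rho (upcoef c N * shiftp 1 f) = rho (downcoef a m * f).

(** The weight w satisfies w(x) B(x) = w(x + 1) D_0(x + 1), and the two boundary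
    terms vanish because B(N - 1) = D_0(0) = 0. *)
Lemma Pearson_weight a c N rho : ~ nonpos_int (a - N + 1) -> ~ nonpos_int c ->
  (exists M : nat, [/\ (0 < M)%N, N = M%:R
     & forall p : {poly R},
         rho p = Gamma N *
           \sum_(x < M) Gamma (a - x%:R) * Gamma (x%:R + c)
                        / (Gamma (N - x%:R) * (x`!)%:R) * p.[x%:R]]) ->
  Pearson a c N 0 rho.
Proof.
move=> ha hc [[|M] [// _ NE rhoE]] f; rewrite !rhoE; congr (_ * _).
rewrite big_ord_recr [RHS]big_ord_recl /=.
have -> : (upcoef c N * shiftp 1 f).[M%:R] = 0.
  by rewrite /upcoef !hornerE NE -natr1 addrK subrr mulr0 mul0r.
have -> : (downcoef a 0 * f).[0] = 0.
  by rewrite /downcoef !hornerM !hornerE; ring.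
rewrite !mulr0 addr0 add0r; apply: eq_bigr => i _; rewrite /bump leq0n add1n.
have Ga : Gamma (a - i%:R) = (a - i.+1%:R) * Gamma (a - i.+1%:R).
  rewrite -Gamma_rec.
    by congr Gamma; rewrite -natr1; ring.
  have := nonpos_intD _ _ (M - i.+1) ha; congr (~ nonpos_int _).
  by rewrite NE natrB ?ltn_ord//; ring.
have Gc : Gamma (i.+1%:R + c) = (i%:R + c) * Gamma (i%:R + c).
  rewrite -Gamma_rec.
    by congr Gamma; rewrite -natr1; ring.
  by rewrite addrC; apply: nonpos_intD.
have nz : N - i.+1%:R != 0.
  by rewrite NE subr_eq0 eqr_nat eqSS gtn_eqF.
have GN : Gamma (N - i%:R) = (N - i.+1%:R) * Gamma (N - i.+1%:R).
  rewrite -Gamma_rec.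
    by congr Gamma; rewrite -natr1; ring.
  move=> [j /eqP]; rewrite NE -addr_eq0 addrAC -natrD subr_eq0 eqr_nat => /eqP.
  by have := ltn_ord i; lia.
rewrite Ga Gc GN /upcoef /downcoef !hornerE horner_shiftp factS natrM.
rewrite !invfM.
have -> : i%:R + 1%:~R = i.+1%:R :> R by rewrite natr1.
have i0 : i.+1%:R != 0 :> R by rewrite pnatr_eq0.
move: (Gamma (N - _))^-1 (i`!%:R^-1) => u v.
rewrite -[N - 1 - i%:R]addrA -opprD nat1r.
rewrite /=; field; by rewrite nat1r i0 nz.
Qed.

Section PearsonFunctional.
Variables (a c N m : R) (rho : {scalar {poly R}}).
Hypothesis rhoP : Pearson a c N m rho.

(** Summation by parts: the Dirichlet form of the operator, symmetric in f and g. *)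
Lemma hahn_op_Dirichlet f g :
  rho (g * hahn_op a c N m f) = rho (downcoef a m * (nabla g * nabla f)).
Proof.
have -> : g * hahn_op a c N m f =
   downcoef a m * (g * nabla f) -
   upcoef c N * shiftp 1 (shiftp (-1) g * nabla f).
  rewrite rmorphM /= /nabla rmorphB /= !shiftp_comp subrr !shiftp0.
  by rewrite /hahn_op /nabla; ring.
by rewrite linearB rhoP -linearB /= -mulrBr -mulrBl.
Qed.

Lemma hahn_op_sym f g : rho (g * hahn_op a c N m f) = rho (f * hahn_op a c N m g).
Proof. by rewrite !hahn_op_Dirichlet [nabla g * _]mulrC. Qed.

Lemma hahn_op_mean0 f : rho (hahn_op a c N m f) = 0.
Proof.
by have := hahn_op_sym f 1; rewrite mul1r -polyC1 hahn_op_const mulr0 linear0.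
Qed.

(** By induction on the size of g: L_m g is the eigenvalue times g up to a
    polynomial of smaller size, so symmetry equates two distinct multiples of
    rho (f * g). *)
Lemma eigen_orthogonal n f g :
  (forall j, (j < n)%N -> hahn_eigval a c N m j != hahn_eigval a c N m n) ->
  hahn_op a c N m f = hahn_eigval a c N m n *: f -> (size g <= n)%N ->
  rho (f * g) = 0.
Proof.
move=> sep ef; suff main d : (d <= n)%N -> (size g <= d)%N -> rho (f * g) = 0.
  exact: (main n).
elim: d g => [|d IH] g dn sg.
  by move: sg; rewrite size_poly_leq0 => /eqP ->; rewrite mulr0 linear0.
have := hahn_op_triangular a c N m _ _ sg => /(IH _ (ltnW dn)).
rewrite mulrBr linearB /= -scalerAr linearZ /= hahn_op_sym ef -scalerAr linearZ /=.
rewrite [g * f]mulrC -mulrBl => /eqP; rewrite mulf_eq0 subr_eq0 eq_sym.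
by rewrite (negPf (sep _ dn)) => /eqP.
Qed.

End PearsonFunctional.

(** The difference of the two sides of Pearson's equation at nabla g is the mean
    of L_0 g. *)
Lemma Pearson_of_mean0 a c N rho : (forall g, rho (hahn_op a c N 0 g) = 0) ->
  Pearson a c N 0 rho.
Proof.
move=> h f; have [g ->] := nabla_surj f.
apply/eqP; rewrite -subr_eq0 -linearB /= -oppr_eq0 -linearN /=; apply/eqP.
rewrite -[RHS](h g); congr (rho _).
rewrite /hahn_op /nabla rmorphB /= shiftp_comp subrr shiftp0; ring.
Qed.

(** The operator sends a Hahn polynomial to a multiple of itself, which has mean
    zero in positive degree; in degree zero the eigenvalue vanishes. *)
Lemma Pearson_hahn a c N rho : ~ nonpos_int (a + c - N + 1) ->
  orthogonal_polys rho None (hahn a c N) -> Pearson a c N 0 rho.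
Proof.
move=> hs ort; apply: Pearson_of_mean0 => g.
move: {2}(size g) (leqnn (size g)) => d; elim: d g => [|d IH] g sg.
  by move: sg; rewrite size_poly_leq0 => /eqP ->; rewrite !linear0.
have [s0 o1 _] := ort d isT.
have := size_cancel_lead _ _ _ sg s0; set t := _ / _; set h := hahn a c N d => sw.
rewrite -[g](subrK (t *: h)) (linearD (hahn_op a c N 0)) linearD /= IH// add0r.
rewrite [hahn_op a c N 0 (_ *: _)]linearZ /= linearZ /= hahn_eigen ?linearZ /=.
  suff -> : hahn_eigval a c N 0 d * rho h = 0 by rewrite mulr0.
  case: (posnP d) => [->|d0]; first by rewrite /hahn_eigval !mul0r.
  by have := o1 0 d0; rewrite expr0 mulr1 => ->; rewrite mulr0.
move=> j; case: (d + j)%N => // i _; apply/eqP => e; apply: hs; exists i.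
by apply/eqP; rewrite -subr_eq0 opprK -e -natr1; apply/eqP; ring.
Qed.

Lemma Pearson_mulfun a c N rho (m : nat) : Pearson a c N 0 rho ->
  Pearson a c N m%:R (mulfun (desc 0 m) rho).
Proof.
move=> rhoP f; rewrite /= /mulfun.
have -> : desc 0 m * (upcoef c N * shiftp 1 f) =
    upcoef c N * shiftp 1 (desc 1 m * f).
  rewrite rmorphM /= mulrCA; congr (_ * (_ * _)).
  apply: eq_poly_horner => x; rewrite horner_shiftp !horner_desc.
  by congr poch; ring.
rewrite rhoP; congr (rho _); rewrite !mulrA; congr (_ * _).
apply: eq_poly_horner => x; rewrite /downcoef !hornerM !horner_desc !hornerE /=.
have e : - x * poch (1 - x) m = poch (- x) m * (m%:R - x).
  by rewrite [1 - x]addrC -poch_recl pochS [m%:R - x]addrC.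
rewrite ?sub0r ?add0r.
transitivity (- (a - x) * (- x * poch (1 - x) m)); first by ring.
by rewrite e; ring.
Qed.

(** * Moments of eigenfunctions and the dual Hahn polynomial *)

(** Pearson's equation, applied to f(x - 1), removes the shifted term. *)
Lemma moment_nabla a c N rho (m : nat) f : Pearson a c N 0 rho ->
  rho (desc 0 m.+1 * ((a%:P - 'X) * nabla f)) =
  (a + c - N + m.+1%:R) * rho (desc 0 m.+1 * f) +
  (m%:R + c) * (N - 1 - m%:R) * rho (desc 0 m * f).
Proof.
move=> rhoP; have := Pearson_mulfun _ _ _ _ m rhoP (shiftp (-1) f).
rewrite /= /mulfun shiftp_comp subrr shiftp0 => e.
have -> : desc 0 m.+1 * ((a%:P - 'X) * nabla f) =
   (a + c - N + m.+1%:R) *: (desc 0 m.+1 * f) +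
   ((m%:R + c) * (N - 1 - m%:R)) *: (desc 0 m * f) -
   desc 0 m * (upcoef c N * f) +
   desc 0 m * (downcoef a m%:R * shiftp (-1) f).
  apply: eq_poly_horner => x; rewrite descS /nabla /upcoef /downcoef.
  rewrite !(hornerM, hornerD, hornerN, hornerZ, hornerC, hornerX).
  rewrite !horner_desc horner_shiftp.
  move: (poch _ m) => P.
  by rewrite -natr1; ring.
by rewrite linearD linearB -e subrK linearD !linearZ.
Qed.

(** For the functional (-x)_{m+1} rho the mean of L_{m+1} p is zero, and
    L_{m+1} - L_{k+1} is (k - m)(a - x) nabla, whose mean [moment_nabla]
    computes. *)
Lemma moment_rec a c N rho (k m n : nat) p : Pearson a c N 0 rho ->
  hahn_op a c N k.+1%:R p = hahn_eigval a c N k.+1%:R n *: p ->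
  (hahn_eigval a c N k.+1%:R n + (k%:R - m%:R) * (a + c - N + m.+1%:R)) *
    rho (desc 0 m.+1 * p) =
  - ((k%:R - m%:R) * (m%:R + c) * (N - 1 - m%:R)) * rho (desc 0 m * p).
Proof.
move=> rhoP ep.
have P1 := Pearson_mulfun _ _ _ _ m.+1 rhoP.
have := hahn_op_mean0 _ _ _ _ _ P1 p; rewrite /= /mulfun.
have -> : hahn_op a c N m.+1%:R p =
    hahn_op a c N k.+1%:R p + (k%:R - m%:R) *: ((a%:P - 'X) * nabla p).
  apply: eq_poly_horner => x; rewrite hornerD hornerZ hornerM !horner_hahn_op.
  rewrite /nabla !hornerE horner_shiftp -!natr1 /=; ring.
rewrite ep mulrDr -!scalerAr linearD ![rho (_ *: _)]linearZ /=.
rewrite (moment_nabla _ _ _ _ _ _ rhoP) => e.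
apply/eqP; rewrite -subr_eq0 -[X in _ == X]e; apply/eqP; ring.
Qed.

(** [moment_rec] iterated; the factor (n + 1 + i)(n + 1 + sigma - i) on its left,
    with sigma = a + c - N + k - 1, is X + i(sigma - i) at
    X = (n + 1)(n + 1 + sigma), the factor in the definition of the dual Hahn
    polynomial. *)
Lemma moment_prod a c N rho (k n : nat) p : Pearson a c N 0 rho ->
  hahn_op a c N k.+1%:R p = hahn_eigval a c N k.+1%:R n *: p ->
  forall j, (j <= k)%N ->
  (\prod_(i < j) (n.+1%:R * (n.+1%:R + a + c - N + k%:R - 1) +
       i%:R * (a + c - N + k%:R - 1 - i%:R))) * rho (desc 0 k * p) =
  (j`!)%:R * poch (1 - c - k%:R) j * poch (N - k%:R) j * rho (desc 0 (k - j) * p).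
Proof.
move=> rhoP ep; elim=> [|j IH] jk.
  by rewrite /poch fact0 !big_ord0 subn0 !mul1r.
have := moment_rec _ _ _ _ _ (k - j.+1) _ _ rhoP ep.
have kj : (k - j.+1).+1 = (k - j)%N by lia.
rewrite kj natrB// => e.
rewrite big_ord_recr /= mulrAC IH; last exact: ltnW.
rewrite factS natrM !pochS.
rewrite -[LHS]mulrA [rho _ * _]mulrC.
have -> : n.+1%:R * (n.+1%:R + a + c - N + k%:R - 1) +
   j%:R * (a + c - N + k%:R - 1 - j%:R) =
   hahn_eigval a c N k.+1%:R n +
   (k%:R - (k%:R - j.+1%:R)) * (a + c - N + (k - j)%:R).
  by rewrite /hahn_eigval natrB ?(ltnW jk)// -!natr1; ring.
rewrite e -natr1; ring.
Qed.

Lemma poch_cat (y : R) (j k : nat) : (j <= k)%N ->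
  poch y j * poch (y + j%:R) (k - j) = poch y k.
Proof.
move=> /subnKC {2}<-; elim: (k - j)%N => [|i IH].
  by rewrite addn0 /poch big_ord0 mulr1.
by rewrite addnS !pochS mulrA IH natrD addrA.
Qed.

Lemma poch_ffact (k j : nat) : (j <= k)%N ->
  poch (- k%:R : R) j * (-1) ^+ j = (k ^_ j)%:R.
Proof.
elim: j => [|j IH] jk; first by rewrite /poch big_ord0 mulr1 ffactn0.
rewrite pochS exprSr mulrACA IH ?(ltnW jk)// ffactnSr natrM natrB ?(ltnW jk)//.
by congr (_ * _); ring.
Qed.

Lemma horner_dual_hahn a c N k x : (dual_hahn a c N k).[x] =
  \sum_(j < k.+1) (k ^_ j)%:R * poch (1 - c - k%:R + j%:R) (k - j)
        * poch (N - k%:R + j%:R) (k - j) / (j`!)%:R *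
     \prod_(i < j) (x + i%:R * (a + c - N + k%:R - 1 - i%:R)).
Proof.
rewrite /dual_hahn horner_sum; apply: eq_bigr => -[j /= jk] _; rewrite ltnS in jk.
rewrite hornerZ horner_prod -(poch_ffact _ _ jk); congr (_ * _); first by ring.
by apply: eq_bigr => i _; rewrite !hornerE.
Qed.

Lemma desc1_expand k :
  desc (1 : R) k = \sum_(j < k.+1) (k ^_ j)%:R *: desc 0 (k - j).
Proof.
elim: k => [|k IH]; first by rewrite big_ord1 ffactn0 !desc0 scale1r.
rewrite big_ord_recl subn0 ffactn0 scale1r /=.
transitivity (desc (0 : R) k.+1 + k.+1%:R * desc 1 k).
  rewrite descS desc_recl !add0r -polyC_natr -natr1 !polyCD polyC1; ring.
congr (_ + _); rewrite IH mulr_sumr; apply: eq_bigr => j _.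
rewrite /bump leq0n add1n subSS ffactSS natrM -scalerA.
by rewrite -polyC_natr mul_polyC.
Qed.

(** Both sides are sums over the moments rho ((-x)_{k-j} p), which
    [moment_prod] matches term by term. *)
Lemma dual_hahn_moment a c N rho (k n : nat) p : Pearson a c N 0 rho ->
  hahn_op a c N k.+1%:R p = hahn_eigval a c N k.+1%:R n *: p ->
  (dual_hahn a c N k).[n.+1%:R * (n.+1%:R + a + c - N + k%:R - 1)] *
    rho (desc 0 k * p) =
  poch (1 - c - k%:R) k * poch (N - k%:R) k * rho (desc 1 k * p).
Proof.
move=> rhoP ep.
rewrite desc1_expand.
rewrite horner_dual_hahn mulr_suml mulr_suml linear_sum mulr_sumr.
apply: eq_bigr => -[j /= jk] _; rewrite ltnS in jk.
have mp := moment_prod _ _ _ _ _ _ _ rhoP ep _ jk.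
have rhoZ : rho ((k ^_ j)%:R *: desc 0 (k - j) * p) =
    (k ^_ j)%:R * rho (desc 0 (k - j) * p) by rewrite -scalerAl linearZ.
rewrite -[LHS]mulrA mp rhoZ.
rewrite -(poch_cat (1 - c - k%:R) _ _ jk) -(poch_cat (N - k%:R) _ _ jk).
have h2 : j`!%:R != 0 :> R by rewrite pnatr_eq0 -lt0n fact_gt0.
by field.
Qed.

Lemma dual_hahn0 a c N k :
  (dual_hahn a c N k).[0] = poch (1 - c - k%:R) k * poch (N - k%:R) k.
Proof.
rewrite horner_dual_hahn big_ord_recl [X in _ + X]big1 ?addr0.
  by rewrite big_ord0 ffactn0 subn0 fact0 invr1 !mulr1 mul1r.
by move=> i _; rewrite big_ord_recl /= mul0r addr0 mul0r mulr0.
Qed.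

Lemma pF_iota k : pF R (iota 1 k) = (-1) ^+ k *: desc 1 k.
Proof.
rewrite /pF; elim: k => [|k IH]; first by rewrite big_nil desc0 scale1r.
rewrite -[X in iota 1 X]addn1 iotaD big_cat big_seq1 /= IH descS nat1r add1n.
rewrite -scalerAl.
by rewrite -[RHS]mul_polyC -[LHS]mul_polyC exprS !polyCM polyCN polyC1; ring.
Qed.

Lemma mulX_pF k : 'X * pF R (iota 1 k) = (-1) ^+ k.+1 *: desc 0 k.+1.
Proof.
apply: eq_poly_horner => x; rewrite pF_iota hornerM !hornerZ hornerX !horner_desc.
by rewrite poch_recl exprS !sub0r [- x + 1]addrC; ring.
Qed.

(** * A summation formula for the dual Hahn polynomial *)

(** The products that occur in the definition of the dual Hahn polynomial; the
    value at x(x + s) is the product of the (x + i)(x + s - i). *)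
Definition dual_basis (s : R) j : {poly R} :=
  \prod_(i < j) ('X + (i%:R * (s - i%:R))%:P).

Lemma dual_basis_telescope s j x (X0 := x * (x + s)) (X1 := (x + 1) * (x + 1 + s)) :
  (dual_basis s j).[X1] * (x * (x + 1 + s - j%:R)) =
  (dual_basis s j).[X0] * ((x + j%:R) * (x + 1 + s)).
Proof.
rewrite /dual_basis; elim: j => [|j IH]; first by rewrite !big_ord0 !hornerE /=; ring.
rewrite !big_ord_recr /= !hornerM !hornerE /=.
have -> : X1 + j%:R * (s - j%:R) = (x + 1 + j%:R) * (x + 1 + s - j%:R).
  by rewrite /X1; ring.
have -> : X0 + j%:R * (s - j%:R) = (x + j%:R) * (x + s - j%:R) by rewrite /X0; ring.
move: IH; set A := _.[X1]; set B := _.[X0] => IH.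
transitivity ((x + 1 + j%:R) * (x + s - j%:R) * (A * (x * (x + 1 + s - j%:R)))).
  by rewrite -natr1; ring.
by rewrite IH -natr1; ring.
Qed.

Lemma size_dual_basis s j : size (dual_basis s j) = j.+1 /\ (dual_basis s j)`_j = 1.
Proof.
have -> : dual_basis s j = \prod_(i < j) ('X - (- (i%:R * (s - i%:R)))%:P).
  by apply: eq_bigr => i _; rewrite polyCN opprK.
have sz := size_prod_XsubC (index_enum 'I_j) (fun i => - (i%:R * (s - i%:R))).
rewrite /index_enum -enumT size_enum_ord enumT in sz; rewrite sz; split=> //.
have := monic_prod_XsubC (index_enum 'I_j) xpredT (fun i => - (i%:R * (s - i%:R))).
by rewrite monicE /lead_coef sz => /eqP.
Qed.

(** The antidifference is a combination of the basis elements of index j + 1 and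
    j; its coefficients come from comparing both sides at x = - j and in the
    highest degree. *)
Lemma dual_basis_sum s j : exists P : {poly R},
  [/\ (size P <= j.+2)%N, P`_j.+1 = - (j.+1%:R)^-1 &
   forall x, P.[(x + 1) * (x + 1 + s)] - P.[x * (x + s)] =
     - ((x + s / 2) * (dual_basis s j).[x * (x + s)] +
        (x + 1 + s / 2) * (dual_basis s j).[(x + 1) * (x + 1 + s)])].
Proof.
have [sz1 l1] := size_dual_basis s j.+1; have [sz0 l0] := size_dual_basis s j.
exists (- (j.+1%:R^-1 *: dual_basis s j.+1 +
           (j%:R - s / 2) *: dual_basis s j)); split.
- rewrite size_polyN; apply: leq_trans (size_polyD _ _) _; rewrite geq_max.
  by apply/andP; split; apply: leq_trans (size_scale_leq _ _) _; rewrite ?sz1 ?sz0.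
- by rewrite coefN coefD !coefZ l1 mulr1 [_`_j.+1]nth_default ?sz0// mulr0 addr0.
move=> x; have := dual_basis_telescope s j x.
have hS y : (dual_basis s j.+1).[y] =
    (dual_basis s j).[y] * (y + j%:R * (s - j%:R)).
  by rewrite /dual_basis big_ord_recr hornerM !hornerE.
rewrite !(hornerN, hornerD, hornerZ) !hS.
set A := (dual_basis s j).[(x + 1) * (x + 1 + s)].
set B := (dual_basis s j).[x * (x + s)] => e.
have j0 : j.+1%:R != 0 :> R by rewrite pnatr_eq0.
(* Multiplied by j + 1, the two sides differ by the telescoping identity. *)
apply: (mulfI j0); apply/eqP; rewrite -subr_eq0.
have -> : 0 = B * ((x + j%:R) * (x + 1 + s)) - A * (x * (x + 1 + s - j%:R)) :> R.
  by rewrite e subrr.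
apply/eqP; rewrite -natr1 in j0 *; field.
by rewrite natr1 pnatr_eq0.
Qed.

Lemma dual_hahn_basis a c N k : exists2 t : nat -> R, t k = 1 &
  dual_hahn a c N k = \sum_(j < k.+1) t j *: dual_basis (a + c - N + k%:R - 1) j.
Proof.
exists (fun j => poch (- k%:R) j * poch (1 - c - k%:R + j%:R) (k - j)
        * poch (N - k%:R + j%:R) (k - j) / (j`!)%:R * (-1) ^+ j) => //.
by rewrite subnn {2 3}/poch !big_ord0 !mulr1 mulrAC poch_ffact// ffactnn divff//.
Qed.

Lemma dual_hahn_lead a c N k :
  size (dual_hahn a c N k) = k.+1 /\ (dual_hahn a c N k)`_k = 1.
Proof.
have [t tk ->] := dual_hahn_basis a c N k; set s := _ - 1.
rewrite big_ord_recr /= tk scale1r; have [sk lk] := size_dual_basis s k.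
set w := \sum_(_ < _) _; have sw : (size w <= k)%N.
  apply: leq_trans (size_sum _ _ _) _; apply/bigmax_leqP => i _.
  by apply: leq_trans (size_scale_leq _ _) _; case: (size_dual_basis s i) => ->.
split; first by rewrite addrC size_polyDl sk.
by rewrite coefD lk [w`_k]nth_default// add0r.
Qed.

Lemma dual_hahn_sum a c N k (s := a + c - N + k%:R - 1) : exists P : {poly R},
  [/\ (size P <= k.+2)%N, P`_k.+1 = - (k.+1%:R)^-1 &
   forall x, P.[(x + 1) * (x + 1 + s)] - P.[x * (x + s)] =
     - ((x + s / 2) * (dual_hahn a c N k).[x * (x + s)] +
        (x + 1 + s / 2) * (dual_hahn a c N k).[(x + 1) * (x + 1 + s)])].
Proof.
have [t tk ->] := dual_hahn_basis a c N k; rewrite -/s.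
have [P PE] := choice (dual_basis_sum s).
have sP j : (size (P j) <= j.+2)%N by case: (PE j).
exists (\sum_(j < k.+1) t j *: P j); split.
- apply: leq_trans (size_sum _ _ _) _; apply/bigmax_leqP => i _.
  apply: leq_trans (size_scale_leq _ _) _; apply: leq_trans (sP _) _.
  by rewrite !ltnS -ltnS.
- rewrite coef_sum big_ord_recr /= coefZ tk mul1r big1 ?add0r; first by case: (PE k).
  move=> i _; rewrite coefZ nth_default ?mulr0//.
  by apply: leq_trans (sP _) _; rewrite ltnS.
- move=> x; rewrite !horner_sum !mulr_sumr -big_split /= -sumrB -sumrN.
  apply: eq_bigr => i _; rewrite !hornerZ -mulrBr; case: (PE i) => _ _ ->; ring.
Qed.

(** * Difference operators by their coefficients *)

Definition shift_form n C f : {poly R} :=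
  \sum_(i < (2 * n).+1) C i * shiftp (i%:Z - n%:Z) f.

Definition three_term b0 b1 b2 f : {poly R} :=
  b0 * shiftp (-1) f + b1 * f + b2 * shiftp 1 f.

Lemma shift_formD n C C' f :
  shift_form n (fun i => C i + C' i) f = shift_form n C f + shift_form n C' f.
Proof. by rewrite /shift_form -big_split; apply: eq_bigr => i _ /=; rewrite mulrDl. Qed.

Lemma shift_form_id n p f :
  shift_form n (fun i => if i == n then p else 0) f = p * f.
Proof.
have nn : (n < (2 * n).+1)%N by lia.
rewrite /shift_form (bigD1 (Ordinal nn)) //= eqxx subrr shiftp0 big1 ?addr0// => i.
by rewrite -val_eqE /= => /negPf ->; rewrite mul0r.
Qed.

Lemma three_term_form n C b0 b1 b2 : exists C',
  [/\ forall f, three_term b0 b1 b2 (shift_form n C f) = shift_form n.+1 C' f,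
      C' 0 = b0 * shiftp (-1) (C 0)
    & C' (2 * n.+1)%N = b2 * shiftp 1 (C (2 * n)%N)].
Proof.
(* Extending C by zero lets the three shifted copies share one index range. *)
pose cc i := if (i <= 2 * n)%N then C i else 0.
pose c0 i := b0 * shiftp (-1) (cc i).
pose c1 i := if i is i'.+1 then b1 * cc i' else 0.
pose c2 i := if i is i'.+2 then b2 * shiftp 1 (cc i') else 0.
have cc_ge i : (2 * n < i)%N -> cc i = 0 by move=> h; rewrite /cc leqNgt h.
have n2 : (2 * n.+1 = (2 * n).+2)%N by lia.
exists (fun i => c0 i + c1 i + c2 i); split; last first.
- have ccn : cc (2 * n)%N = C (2 * n)%N by rewrite /cc leqnn.
  by rewrite n2 /c0 /c1 /c2 ccn !cc_ge// rmorph0 !mulr0 !add0r.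
- by rewrite /c0 /c1 /c2 /cc leq0n !addr0.
move=> f; rewrite !shift_formD /three_term /shift_form n2.
have ccE (i : 'I_(2 * n).+1) : cc i = C i by rewrite /cc -ltnS ltn_ord.
congr (_ + _ + _).
- rewrite [RHS]big_ord_recr [X in _ = X + _]big_ord_recr /= /c0 !cc_ge//.
  rewrite rmorph0 !mulr0 !mul0r !addr0.
  rewrite rmorph_sum mulr_sumr; apply: eq_bigr => i _ /=.
  rewrite ccE rmorphM /= shiftp_comp mulrA; congr (_ * shiftp _ _); lia.
- rewrite [RHS]big_ord_recl [X in _ = _ + X]big_ord_recr /= /c1 /bump leq0n add1n cc_ge//.
  rewrite mulr0 !mul0r add0r addr0 mulr_sumr; apply: eq_bigr => i _ /=.
  rewrite add1n ccE mulrA; congr (_ * shiftp _ _); lia.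
- rewrite [RHS]big_ord_recl [X in _ = _ + X]big_ord_recl /= /c2 !mul0r !add0r.
  rewrite rmorph_sum mulr_sumr; apply: eq_bigr => i _ /=.
  rewrite /bump !leq0n !add1n ccE rmorphM /= shiftp_comp mulrA.
  congr (_ * shiftp _ _); lia.
Qed.

(** The polynomial with coefficients s, evaluated at the operator L by Horner's
    rule. *)
Definition poly_op (L : {poly R} -> {poly R}) (s : seq R) f : {poly R} :=
  foldr (fun t g => t *: f + L g) 0 s.

Lemma poly_op_eigen (L : {linear {poly R} -> {poly R}}) (p : {poly R}) f t :
  L f = t *: f -> poly_op L p f = p.[t] *: f.
Proof.
move=> ef; rewrite horner_coef; elim: {p}(p : seq R) => [|x s IH] /=.
  by rewrite big_ord0 scale0r.
rewrite IH linearZ /= ef scalerA -scalerDl big_ord_recl expr0 mulr1.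
congr ((_ + _) *: _).
by rewrite mulr_suml; apply: eq_bigr => i _; rewrite exprSr mulrA.
Qed.

Lemma poly_op_linear (L : {linear {poly R} -> {poly R}}) (s : seq R) : linear (poly_op L s).
Proof.
move=> t f g; elim: s => [|x s IH] /=; first by rewrite scaler0 addr0.
by rewrite IH [L _]linearP /= !scalerDr !scalerA [x * t]mulrC addrACA.
Qed.

(** The coefficient of the shift by n l in the n-th power of an operator whose
    extreme term is b times the shift by l. *)
Definition end_coef (l : int) b n : {poly R} := iter n (fun w => b * shiftp l w) 1.

Lemma poly_op_form (L : {linear {poly R} -> {poly R}}) b0 b1 b2 n (s : seq R) :
  (forall f, L f = three_term b0 b1 b2 f) -> size s = n.+1 ->
  exists C, [/\ forall f, poly_op L s f = shift_form n C f,
    C 0 = s`_n *: end_coef (-1) b0 n & C (2 * n)%N = s`_n *: end_coef 1 b2 n].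
Proof.
move=> LE; elim: s n => [|x [|y s] IH] [|n] //= => [_|[ss]].
  exists (fun _ => x%:P); split; rewrite ?alg_polyC// => f.
  by rewrite linear0 addr0 /shift_form muln0 big_ord1 subrr shiftp0 mul_polyC.
have [C [CE C0 C2]] := IH n (congr1 S ss).
have [C' [C'E C'0 C'2]] := three_term_form n C b0 b1 b2.
exists (fun i => C' i + (if i == n.+1 then x%:P else 0)); split.
- by move=> f; rewrite shift_formD -C'E -CE LE shift_form_id mul_polyC addrC.
- by rewrite addr0 C'0 C0 linearZ /= scalerAr.
- have -> : (2 * n.+1 == n.+1)%N = false by lia.
  by rewrite addr0 C'2 C2 linearZ /= scalerAr.
Qed.

Lemma end_coef_neq0 l b n : b != 0 -> end_coef l b n != 0.
Proof.
move=> b0; elim: n => [|n IH]; first exact: oner_neq0.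
by rewrite /end_coef iterS mulf_neq0// shiftp_neq0.
Qed.

Lemma shift_form_diffop n C : C 0 != 0 -> C (2 * n)%N != 0 ->
  exists D : diffop R, [/\ diffop_order D = (2 * n)%N,
    diffop_genre D = (- n%:Z, n%:Z) & forall f, diffop_app D f = shift_form n C f].
Proof.
move=> C0 C2; pose co (l : int) := C (absz (l + n%:Z)).
have le : - n%:Z <= n%:Z by lia.
have lo : co (- n%:Z) != 0 by rewrite /co addNr.
have hi : co n%:Z != 0 by rewrite /co (_ : absz _ = (2 * n)%N)//; lia.
exists (DiffOp le lo hi).
have ord : diffop_order (DiffOp le lo hi) = (2 * n)%N.
  by rewrite /diffop_order /=; lia.
split=> // f; rewrite /diffop_app ord; apply: eq_bigr => i _ /=.
congr (_ * shiftp _ _); last by rewrite addrC.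
by rewrite /co; congr C; lia.
Qed.

(** * The Krall-Hahn operator *)

Definition hahn_op_shift a c N m t f : {poly R} := hahn_op a c N m f + t *: f.

Fact hahn_op_shift_is_linear a c N m t : linear (hahn_op_shift a c N m t).
Proof.
move=> z f g; rewrite /hahn_op_shift linearP.
rewrite [t *: (_ + _)]scalerDr [z *: (_ + _)]scalerDr !scalerA.
by rewrite [t * z]mulrC addrACA.
Qed.

HB.instance Definition _ a c N m t := GRing.isLinear.Build R {poly R} {poly R} *:%R
  (hahn_op_shift a c N m t) (hahn_op_shift_is_linear a c N m t).

Lemma hahn_op_shift_three_term a c N m t f : hahn_op_shift a c N m t f =
  three_term (- downcoef a m) (upcoef c N + downcoef a m + t%:P) (- upcoef c N) f.
Proof. by rewrite /hahn_op_shift /three_term /hahn_op /nabla -mul_polyC; ring. Qed.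

Lemma slope_op_three_term a t f : slope_op a f + t *: f =
  three_term (- ('X - a%:P)) ('X - a%:P + t%:P) 0 f.
Proof. by rewrite /slope_op /three_term /nabla -mul_polyC; ring. Qed.

Lemma upcoef_neq0 c N : upcoef c N != 0.
Proof.
rewrite mulf_neq0//; first by rewrite -size_poly_gt0 size_XaddC.
by rewrite -opprB oppr_eq0 polyXsubC_eq0.
Qed.

Lemma subXC_neq0 a : a%:P - 'X != 0 :> {poly R}.
Proof. by rewrite -opprB oppr_eq0 polyXsubC_eq0. Qed.

Lemma downcoef_neq0 a m : downcoef a m != 0.
Proof. by rewrite mulf_neq0 ?polyXsubC_eq0 ?subXC_neq0. Qed.

(** At the upper end only P(Lambda) contributes.  At the lower end both terms do,
    and their sum is nonzero thanks to the relation between the leading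
    coefficients of P and Y. *)
Lemma krall_hahn_diffop a c N (k : nat) (t t' : R) (P Y : {poly R}) :
  size P = k.+2 -> P`_k.+1 = - k.+1%:R^-1 -> size Y = k.+1 -> Y`_k = 1 ->
  exists D : diffop R, [/\ diffop_order D = (2 * k.+1)%N,
    diffop_genre D = (- k.+1%:Z, k.+1%:Z) &
    forall f, diffop_app D f = poly_op (hahn_op_shift a c N k.+1%:R t) P f +
      (slope_op a (poly_op (hahn_op_shift a c N k.+1%:R t) Y f) +
       t' *: poly_op (hahn_op_shift a c N k.+1%:R t) Y f)].
Proof.
move=> sP lP sY lY.
have k0 : k.+1%:R != 0 :> R by rewrite pnatr_eq0.
pose L : {linear {poly R} -> {poly R}} := hahn_op_shift a c N k.+1%:R t.
have LE f := hahn_op_shift_three_term a c N k.+1%:R t f : L f = _.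
have [C [CE C0 C2]] := poly_op_form L _ _ _ k.+1 P LE sP.
have [C' [C'E C'0 C'2]] := poly_op_form L _ _ _ k Y LE sY.
have [C'' [C''E C''0 C''2]] :=
  three_term_form k C' (- ('X - a%:P)) ('X - a%:P + t'%:P) 0.
have [|| D [oD gD DE]] := shift_form_diffop k.+1 (fun i => C i + C'' i).
- rewrite C0 C''0 C'0 lP lY scale1r.
  rewrite /end_coef iterS -/(end_coef (-1) (- downcoef a k.+1%:R) k).
  set E := end_coef _ _ _.
  have nE : E != 0 by rewrite end_coef_neq0// oppr_eq0 downcoef_neq0.
  have sE : shiftp (-1) E != 0 by rewrite shiftp_neq0.
  have -> : - k.+1%:R^-1 *: (- downcoef a k.+1%:R * shiftp (-1) E) +
      - ('X - a%:P) * shiftp (-1) E =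
      k.+1%:R^-1 *: (shiftp (-1) E * ('X * (a%:P - 'X))).
    apply: eq_poly_horner => x; rewrite /downcoef.
    rewrite !(hornerM, hornerD, hornerN, hornerZ, hornerC, hornerX).
    move: (shiftp _ _).[_] => e; field.
    by rewrite nat1r.
  by rewrite scaler_eq0 invr_eq0 (negPf k0) /= !mulf_neq0 ?polyX_eq0 ?subXC_neq0.
- rewrite C2 C''2 mul0r addr0 lP scaler_eq0 oppr_eq0 invr_eq0 (negPf k0).
  by rewrite end_coef_neq0// oppr_eq0 upcoef_neq0.
exists D; split=> // f; rewrite DE shift_formD -CE -C''E -C'E.
by rewrite -slope_op_three_term.
Qed.

(** * The orthogonal polynomials *)

Lemma orthogonal_unique (mu : {scalar {poly R}}) len q n (r : {poly R}) :
  orthogonal_polys mu len q -> in_family len n -> size r = n.+1 ->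
  (forall j, (j < n)%N -> mu (r * 'X^j) = 0) -> exists t, q n = t *: r.
Proof.
move=> oq ln sr ro; exists ((q n)`_n / r`_n).
have [sq oqn _] := oq n ln.
apply/eqP; rewrite -subr_eq0; set w := _ - _; apply: contraT => w0.
have sw : (size w <= n)%N by apply: size_cancel_lead => //; rewrite sq.
have ow j : (j < n)%N -> mu (w * 'X^j) = 0.
  move=> jn; rewrite /w mulrBl linearB -scalerAl linearZ /= oqn// ro//.
  by rewrite mulr0 subrr.
have [d dE] : exists d, size w = d.+1.
  by exists (size w).-1; rewrite prednK// size_poly_gt0.
have dn : (d < n)%N by rewrite -dE.
have ld : in_family len d by case: len ln {oq} => //= l; exact: ltn_trans.
have [sd od nd] := oq d ld.
(* The product with q d isolates the leading coefficient of w. *)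
have e1 : mu (q d * w) = w`_d * mu (q d * 'X^d).
  rewrite -[in LHS](coefK w) poly_def dE mulr_sumr linear_sum big_ord_recr /=.
  rewrite big1 ?add0r.
    by rewrite -scalerAr linearZ.
  by move=> i _; rewrite -scalerAr linearZ /= od ?mulr0.
have e2 : mu (q d * w) = 0.
  rewrite -(coefK (q d)) poly_def sd mulr_suml linear_sum big1// => i _.
  rewrite [_ * w]mulrC -scalerAr linearZ /= ow ?mulr0//.
  by apply: leq_ltn_trans dn; rewrite -ltnS.
have := lead_coef_eq0 w; rewrite /lead_coef dE /= (negPf w0) => wd.
by move/eqP: e1; rewrite e2 eq_sym mulf_eq0 (negPf nd) orbF wd.
Qed.

Section Functional.
Variables (a c N : R) (k : nat) (rho : {scalar {poly R}}).
Hypothesis rhoP : Pearson a c N 0 rho.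
Hypothesis sep : forall i, (0 < i)%N -> i%:R + (a + c - N + k.+1%:R) != 0.

Local Notation nu := (mulfun (pF R (iota 1 k)) rho).
Local Notation h := (dual_hahn a c N k).
Local Notation xi n := (n%:R * (n%:R + a + c - N + k%:R - 1)).
Local Notation Lk := (hahn_op a c N k.+1%:R).
Local Notation ev := (hahn_eigval a c N k.+1%:R).

Lemma nu_eigen n p : Lk p = ev n *: p ->
  h.[0] * nu p = (-1) ^+ k * h.[xi n.+1] * rho (desc 0 k * p).
Proof.
move=> ep; rewrite -mulrA (dual_hahn_moment _ _ _ _ _ _ _ rhoP ep) dual_hahn0.
have -> : nu p = (-1) ^+ k * rho (desc 1 k * p).
  by rewrite /= /mulfun pF_iota -scalerAl linearZ.
ring.
Qed.

(** Orthogonality to 1 is the relation [nu_eigen] for P and Q; orthogonality to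
    x^{j+1} is that of P and Q to x^j for the functional x nu. *)
Lemma nu_orthogonal n (P Q : {poly R}) :
  h.[0] != 0 -> rho (desc 0 k * (P + Q)) = 0 ->
  Lk P = ev n.+1 *: P -> Lk Q = ev n *: Q -> forall j, (j < n.+1)%N ->
  nu ((h.[xi n.+1] *: P + h.[xi n.+2] *: Q) * 'X^j) = 0.
Proof.
move=> h0 PQ eP eQ [|j] jn.
  rewrite expr0 mulr1; apply: (mulfI h0); rewrite mulr0 linearD !linearZ /=.
  have := nu_eigen _ _ eP; have := nu_eigen _ _ eQ => hQ hP.
  transitivity (h.[xi n.+1] * (h.[0] * nu P) + h.[xi n.+2] * (h.[0] * nu Q)).
    by ring.
  rewrite hP hQ.
  transitivity ((-1) ^+ k * h.[xi n.+1] * h.[xi n.+2] * rho (desc 0 k * (P + Q))).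
    by rewrite [desc 0 k * (P + Q)]mulrDr [rho (_ + _)]linearD /=; ring.
  by rewrite PQ mulr0.
have Pk := Pearson_mulfun _ _ _ _ k.+1 rhoP.
have orth i p g : Lk p = ev i *: p -> (size g <= i)%N ->
    rho (desc 0 k.+1 * (p * g)) = 0.
  move=> ep sg; have := eigen_orthogonal _ _ _ _ _ Pk i p g; apply=> //.
  by move=> l li; apply: hahn_eigval_inj.
have sX : (size ('X^j : {poly R})%R <= n)%N by rewrite size_polyXn.
rewrite /= /mulfun.
have -> : pF R (iota 1 k) * ((h.[xi n.+1] *: P + h.[xi n.+2] *: Q) * 'X^(j.+1)) =
   (-1) ^+ k.+1 *: (h.[xi n.+1] *: (desc 0 k.+1 * (P * 'X^j)) +
                    h.[xi n.+2] *: (desc 0 k.+1 * (Q * 'X^j))).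
  transitivity (('X * pF R (iota 1 k)) *
    ((h.[xi n.+1] *: P + h.[xi n.+2] *: Q) * 'X^j)); first by rewrite exprS; ring.
  by rewrite mulX_pF -!mul_polyC; ring.
rewrite linearZ /= linearD /= [rho (_ *: (_ * (P * _)))]linearZ.
rewrite [rho (_ *: (_ * (Q * _)))]linearZ /=.
by rewrite (orth _ _ _ eP) ?(orth _ _ _ eQ)// ?mulr0 ?addr0 ?mulr0// leqW.
Qed.

(** Here L_k maps x to a nonzero constant, whose mean must vanish. *)
Lemma nu_const_eq0 : a + c - N + k.+1%:R = 0 -> h.[0] != 0 ->
  a + c != 0 -> c + k%:R != 0 -> nu 1 = 0.
Proof.
move=> s0 h0 ac ck.
have L1 : Lk 1 = ev 0 *: 1.
  by rewrite -polyC1 hahn_op_const /hahn_eigval mul0r scale0r.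
have := nu_eigen _ _ L1; suff -> : rho (desc 0 k * 1) = 0.
  by rewrite mulr0 => /eqP; rewrite mulf_eq0 (negPf h0) => /eqP.
have Pk := Pearson_mulfun _ _ _ _ k rhoP.
have := hahn_op_mean0 _ _ _ _ _ Pk 'X; rewrite /= /mulfun.
have -> : hahn_op a c N k%:R 'X = - ((a + c) * (c + k%:R)) *: 1.
  apply: eq_poly_horner => x; rewrite horner_hahn_op !hornerE /=.
  have -> : N = a + c + k%:R + 1 by move: s0; rewrite -natr1; lra.
  ring.
rewrite -scalerAr linearZ /= => /eqP.
rewrite mulf_eq0 oppr_eq0 mulf_eq0 (negPf ac) (negPf ck).
by move/eqP.
Qed.

End Functional.

End KrallHahn.

Theorem corollary7p9 (R : realType) (k : nat) (a c N : R)
    (hk : (0 < k)%N)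
    (h1 : ~ nonpos_int (a + c - N + k%:R + 2))
    (h2 : ~ nonpos_int (a - N + 1))
    (h3 : ~ nonpos_int (a + c))
    (h4 : ~ nonpos_int c)
    (hh : forall n : nat,
        (dual_hahn a c N k).[n%:R * (n%:R + a + c - N + k%:R - 1)] != 0)
    (rho : {scalar {poly R}}) (hrho : hahn_functional a c N rho) :
  exists D : diffop R,
    [/\ diffop_order D = (2 * k + 2)%N,
        diffop_genre D = (- (k.+1%:Z), k.+1%:Z)
      & forall (len : option nat) (q : nat -> {poly R}),
          orthogonal_polys (mulfun (pF R (iota 1 k)) rho) len q ->
          common_eigenfunctions D len q].
Proof.
have rhoP : Pearson a c N 0 rho.
  case: hrho => [hw|[_ [hs _ _ _] ho _]]; first exact: Pearson_weight.
  exact: Pearson_hahn.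
set h := dual_hahn a c N k in hh *.
have h0 : h.[0] != 0 by have := hh 0; rewrite mul0r.
have sep i : (0 < i)%N -> i%:R + (a + c - N + k.+1%:R) != 0.
  case: i => // i _; have := nonpos_int_neq0 _ _ i h1; congr (_ != _).
  by rewrite -!natr1; ring.
have [Pol [sPol lPol sumPol]] := dual_hahn_sum a c N k.
have [sh lh] := dual_hahn_lead a c N k.
have sPol' : size Pol = k.+2.
  apply/eqP; rewrite eqn_leq sPol ltnNge; apply/negP => /leq_sizeP/(_ _ (leqnn _)).
  by rewrite lPol => /eqP; rewrite oppr_eq0 invr_eq0 pnatr_eq0.
pose sg := a + c - N + k%:R - 1.
(* In terms of s = sg + 2, these are the constants s - 1 and s / 2. *)
have [D [oD gD DE]] := krall_hahn_diffop a c N k (sg + 1) (sg / 2 + 1) Pol h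
  sPol' lPol sh lh.
exists D; split; [by rewrite oD; lia|by []|move=> len q oq].
pose xi (n : nat) : R := n%:R * (n%:R + a + c - N + k%:R - 1).
pose L : {linear {poly R} -> {poly R}} := hahn_op_shift a c N k.+1%:R (sg + 1).
have Leig n p : hahn_op a c N k.+1%:R p = hahn_eigval a c N k.+1%:R n *: p ->
    L p = xi n.+1 *: p.
  move=> ep; rewrite /L /= /hahn_op_shift ep -scalerDl; congr (_ *: _).
  by rewrite /hahn_eigval /xi /sg -!natr1; ring.
exists (fun n => Pol.[xi n.+1] + (n%:R + (sg / 2 + 1)) * h.[xi n.+1]) => n ln.
case: n ln => [|n] ln.
  have [/eqP/size_poly1P[t _ ->] _ _] := oq 0 ln.
  have L0 : hahn_op a c N k.+1%:R t%:P = hahn_eigval a c N k.+1%:R 0 *: t%:P.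
    by rewrite hahn_op_const /hahn_eigval mul0r scale0r.
  rewrite DE -/(poly_op L _ _) !(poly_op_eigen L _ _ _ (Leig _ _ L0)).
  have -> : slope_op a (h.[xi 1] *: t%:P) = 0.
    apply: eq_poly_horner => x; rewrite /slope_op /nabla !hornerE horner_shiftp.
    by rewrite !hornerE /=; ring.
  by rewrite add0r scalerA -scalerDl add0r.
(* At s = 0 the family is empty, contrary to ln. *)
have s0 : a + c - N + k.+1%:R != 0.
  apply/eqP => e.
  have l0 : in_family len 0 by case: len ln {oq} => //= l; exact: leq_trans.
  have [/eqP/size_poly1P[t _ qE] _] := oq 0 l0.
  have ac : a + c != 0 by have := nonpos_int_neq0 _ _ 0 h3; rewrite addr0.
  have ck := nonpos_int_neq0 _ _ k h4.
  have n1 := nu_const_eq0 a c N k rho rhoP e h0 ac ck.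
  move=> /negP; apply; apply/eqP; rewrite qE expr0 mulr1 -[t%:P]mulr1 mul_polyC.
  by rewrite linearZ /= n1 mulr0.
(* The Hahn polynomial of degree n + 1 for the operator L_k. *)
pose u := hahn (a - k%:R) (c + k%:R) (N - k%:R) n.+1 \Po ('X - k%:R%:P).
have sepu i : (0 < i)%N -> i%:R + (a + c - N + k%:R) != 0.
  case: i => // -[|i] _.
    by move: s0; congr (_ != _); rewrite -natr1; ring.
  by have := sep i.+1 isT; congr (_ != _); rewrite -!natr1; ring.
have eu : hahn_op a c N k%:R u = hahn_eigval a c N k%:R n.+1 *: u.
  exact: hahn_shifted_eigen.
have su : size u = n.+2.
  by rewrite /u size_comp_poly2 ?size_XsubC// size_hahn.
have k1 : k.+1%:R = k%:R + 1 :> R by rewrite natr1.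
have dlt : 2 * n%:R + 1 + (a + c - N + (k%:R + 1)) != 0.
  by have := sep (2 * n).+1 isT; rewrite -natr1 natrM k1.
have [P [Q [uPQ sP sQ eP eQ]]] := eigen_split _ _ _ _ _ _ dlt su eu.
rewrite -k1 in eP eQ.
have PQ0 : rho (desc 0 k * (P + Q)) = 0.
  have Pk := Pearson_mulfun _ _ _ _ k rhoP.
  have := hahn_op_mean0 _ _ _ _ _ Pk u.
  rewrite eu /= /mulfun -uPQ -scalerAr linearZ /= => /eqP.
  rewrite mulf_eq0 => /orP[|/eqP//].
  rewrite /hahn_eigval mulf_eq0 pnatr_eq0 /= => /eqP e0.
  by have := sepu n.+1 isT; rewrite e0 eqxx.
pose r := h.[xi n.+1] *: P + h.[xi n.+2] *: Q.
have sr : size r = n.+2.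
  have szP : size (h.[xi n.+1] *: P) = n.+2 by rewrite size_scale// (hh n.+1).
  rewrite /r size_polyDl szP// ltnS; exact: leq_trans (size_scale_leq _ _) sQ.
have ro := nu_orthogonal a c N k rho rhoP sep n P Q h0 PQ0 eP eQ.
have [t ->] := orthogonal_unique _ _ _ _ _ oq ln sr ro.
suff Dr : diffop_app D r =
    (Pol.[xi n.+2] + (n.+1%:R + (sg / 2 + 1)) * h.[xi n.+2]) *: r.
  have -> : diffop_app D (t *: r) = t *: diffop_app D r.
    rewrite /diffop_app scaler_sumr; apply: eq_bigr => i _.
    by rewrite linearZ /= scalerAr.
  by rewrite Dr !scalerA [t * _]mulrC.
have Lr (p : {poly R}) : poly_op L p r =
    (h.[xi n.+1] * p.[xi n.+2]) *: P + (h.[xi n.+2] * p.[xi n.+1]) *: Q.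
  have lin := poly_op_linear L p.
  have lin0 : poly_op L p 0 = 0.
    by have := lin (-1) 0 0; rewrite scaler0 addr0 scaleN1r addNr.
  rewrite /r lin -[h.[xi n.+2] *: Q]addr0 lin lin0 addr0.
  rewrite (poly_op_eigen L p _ _ (Leig _ _ eP)).
  by rewrite (poly_op_eigen L p _ _ (Leig _ _ eQ)) !scalerA.
rewrite DE -/(poly_op L _ _) -/(poly_op L _ _) !Lr.
have -> : (h.[xi n.+1] * h.[xi n.+2]) *: P + (h.[xi n.+2] * h.[xi n.+1]) *: Q =
   (h.[xi n.+1] * h.[xi n.+2]) *: u.
  by rewrite uPQ scalerDr [h.[xi n.+2] * _]mulrC.
have Tu : slope_op a u = n.+1%:R *: P - (n%:R + (a + c - N + k.+1%:R)) *: Q.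
  have := hahn_op_slope_op a c N k%:R u; rewrite -k1 eu {1}uPQ linearD /= eP eQ => e.
  have -> : slope_op a u =
     (hahn_eigval a c N k.+1%:R n.+1 *: P + hahn_eigval a c N k.+1%:R n *: Q)
     - hahn_eigval a c N k%:R n.+1 *: (P + Q) by rewrite e -uPQ addrAC subrr add0r.
  apply: eq_poly_horner => x.
  by rewrite !(hornerD, hornerN, hornerZ) /hahn_eigval -!natr1; ring.
have -> : slope_op a ((h.[xi n.+1] * h.[xi n.+2]) *: u) =
    (h.[xi n.+1] * h.[xi n.+2]) *: slope_op a u.
  by rewrite /slope_op linearZ /= scalerAr.
have x0 : xi n.+1 = n.+1%:R * (n.+1%:R + sg) by rewrite /xi /sg; ring.
have x1 : xi n.+2 = (n.+1%:R + 1) * (n.+1%:R + 1 + sg).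
  by rewrite /xi /sg -[n.+2%:R]natr1; ring.
(* The summation formula equates the coefficients of P and Q. *)
have := sumPol n.+1%:R; rewrite -/sg -/h -x0 -x1 => sumE.
have PolE : Pol.[xi n.+1] = Pol.[xi n.+2] + ((n.+1%:R + sg / 2) * h.[xi n.+1] +
    (n.+1%:R + 1 + sg / 2) * h.[xi n.+2]).
  by rewrite -[LHS](subKr Pol.[xi n.+2]) sumE; ring.
rewrite Tu PolE uPQ /r.
apply: eq_poly_horner => x; rewrite !(hornerD, hornerN, hornerZ).
rewrite (_ : n%:R + (a + c - N + k.+1%:R) = n.+1%:R + sg + 1); last first.
  by rewrite /sg -!natr1; ring.
by field.
Qed.
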